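(* Let $\mathcal{E}$ be an existential PBES in normal form (as in the context). Suppose that the sequence $\mathcal{P}_0, H(\mathcal{P}_0), H(H(\mathcal{P}_0)),\dots$ reaches a fixed point, i.e. there is $m$ with $H^{m+1}(\mathcal{P}_0)=H^m(\mathcal{P}_0)$, and let $\mathcal{P}=H^m(\mathcal{P}_0)$. Then the pair $\langle\sim^D_{\mathcal{P}},\sim^B_{\mathcal{P}}\rangle$ is feasible.
   Context: Normal-form existential PBES: equations $\sigma_i X_i(\vec d)=\bigvee_{1\le k\le m_i}\exists\vec e\,\big(\varphi_{ik}(\vec d,\vec e)\wedge X_{a_{ik1}}(\vec f_{ik1}(\vec d,\vec e))\wedge\cdots\wedge X_{a_{ikp_{ik}}}(\vec f_{ikp_{ik}}(\vec d,\vec e))\big)$ for $i=1,\dots,n$, $\sigma_i\in\{\mu,\nu\}$, where the parameters of $X_i$ range over a domain $\mathbb{D}_i$, $\vec e$ ranges over $\mathbb{E}_{ik}$, $\varphi_{ik}$ is a Boolean data expression with free variables among $\vec d,\vec e$, and $\vec f_{ikj}$ are data expressions. Let $\mathrm{sig}(\mathcal{E})=\{X_i(\vec v)\mid 1\le i\le n,\vec v\in\mathbb{D}_i\}$ and $B=\{(i,k,\vec v,\vec w)\mid 1\le i\le n,1\le k\le m_i,\vec v\in\mathbb{D}_i,\vec w\in\mathbb{E}_{ik}\}$. Define $F_{ik}(X_j(\vec v))=\{(i,k,\vec v,\vec w)\mid\varphi_{ik}(\vec v,\vec w)\}$ if $j=i$ and $\emptyset$ otherwise; $G_{ik}(j,k',\vec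 v,\vec w)=\{X_{a_{ik1}}(\vec f_{ik1}(\vec v,\vec w)),\dots,X_{a_{ikp_{ik}}}(\vec f_{ikp_{ik}}(\vec v,\vec w))\}$ if $j=i,k'=k$ and $\emptyset$ otherwise. An equivalence $\sim$ on $A$ extends to subsets by $\alpha\sim\beta$ iff $\{[a]_\sim\mid a\in\alpha\}=\{[b]_\sim\mid b\in\beta\}$. A pair $\langle\sim_D,\sim_B\rangle$ of equivalences on $\mathrm{sig}(\mathcal{E})$ and $B$ is feasible if: (1) $i\ne j$ implies $X_i(\vec v)\not\sim_D X_j(\vec v')$; (2) $X_i(\vec v)\sim_D X_i(\vec v')$ implies $F_{ik}(X_i(\vec v))\sim_B F_{ik}(X_i(\vec v'))$ for all $k$; (3) $i\ne j$ or $k\ne k'$ implies $(i,k,\vec v,\vec w)\not\sim_B(j,k',\vec v',\vec w')$; (4) $(i,k,\vec v,\vec w)\sim_B(i,k,\vec v',\vec w')$ implies $G_{ik}(i,k,\vec v,\vec w)\sim_D G_{ik}(i,k,\vec v',\vec w')$. A partition family is a tuple $\mathcal{P}=\langle\Phi_1,\dots,\Phi_n,\Psi_{11},\dots,\Psi_{nm_n}\rangle$ where $\Phi_i$ is a partition of $\mathbb{D}_i$ and $\Psi_{ik}$ a partition of $\mathbb{D}_i\times\mathbb{E}_{ik}$ (a partition of $A$ being a family of pairwise disjoint sets with union $A$). It induces $\sim^D_{\mathcal{P}}$ on $\mathrm{sig}(\mathcal{E})$: $X_i(\vec v)\sim^D_{\mathcal{P}}X_j(\vec v')$ iff $i=j$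 and $\vec v,\vec v'$ lie in the same block of $\Phi_i$; and $\sim^B_{\mathcal{P}}$ on $B$: $(i,k,\vec v,\vec w)\sim^B_{\mathcal{P}}(j,k',\vec v',\vec w')$ iff $i=j$, $k=k'$ and $(\vec v,\vec w),(\vec v',\vec w')$ lie in the same block of $\Psi_{ik}$. For $\psi\subseteq\mathbb{D}_i\times\mathbb{E}_{ik}$ let $F'_{ik}(\psi)=\{\vec v\mid \exists\vec w.\ (i,k,\vec v,\vec w)\in F_{ik}(X_i(\vec v)),(\vec v,\vec w)\in\psi\}$; for $\phi\subseteq\mathrm{sig}(\mathcal{E})$ let $G'_{ik}(\phi)=\{(\vec v,\vec w)\mid G_{ik}(i,k,\vec v,\vec w)\cap\phi\neq\emptyset\}$. Define $\Phi\otimes^D_{ik}\psi=\{F'_{ik}(\psi)\cap\phi\mid\phi\in\Phi\}\cup\{\overline{F'_{ik}(\psi)}\cap\phi\mid\phi\in\Phi\}$ and $\Psi\otimes^B_{ik}\phi=\{G'_{ik}(\phi)\cap\psi\mid\psi\in\Psi\}\cup\{\overline{G'_{ik}(\phi)}\cap\psi\mid\psi\in\Psi\}$ (overline = complement), extended to finite or arbitrary sets of arguments by successive application (order-independent): $\Phi\otimes\{\psi_1,\dots\}=\Phi\otimes\psi_1\otimes\cdots$. Let $H^D_{ik}(\mathcal{P})$ replace $\Phi_i$ by $\Phi_i\otimes^D_{ik}\Psi_{ik}$, and $H^B_{ik}(\mathcal{P})$ replace $\Psi_{ik}$ by $\Psi_{ik}\otimes^B_{ik}\Delta_D$ where $\Delta_D=\bigcup_{1\le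 j\le p_{ik}}\{\{X_{a_{ikj}}(\vec v)\mid\vec v\in\phi\}\mid\phi\in\Phi_{a_{ikj}}\}$, all other components unchanged. Set $H^D=H^D_{nm_n}\circ\cdots\circ H^D_{11}$, $H^B=H^B_{nm_n}\circ\cdots\circ H^B_{11}$, $H=H^B\circ H^D$, and $\mathcal{P}_0=\langle\{\mathbb{D}_1\},\dots,\{\mathbb{D}_n\},\{\mathbb{D}_1\times\mathbb{E}_{11}\},\dots,\{\mathbb{D}_n\times\mathbb{E}_{nm_n}\}\rangle$. *)

(* Defs.v *)
From mathcomp Require Import all_boot.
From mathcomp Require Import boolp classical_sets.
From Stdlib Require Import RelationClasses.

Set Implicit Arguments.
Unset Strict Implicit.
Unset Printing Implicit Defensive.

Local Open Scope classical_set_scope.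

(** ** Partitions *)

(* Empty blocks are allowed, contrary to [classical_sets.partition]. *)
Definition is_partition (A : Type) (P : set (set A)) : Prop :=
  trivIset P id /\ cover P id = [set: A].

Record partition_of (A : Type) := Partition {
  blocks :> set (set A);
  blocksP : is_partition blocks }.

Lemma partition_ext (A : Type) (P Q : partition_of A) :
  blocks P = blocks Q -> P = Q.
Proof.
case: P Q => [P hP] [Q hQ] /= e; subst Q; congr Partition.
exact: Prop_irrelevance.
Qed.

Definition same_block (A : Type) (P : set (set A)) (x y : A) : Prop :=
  exists2 b, P b & b x /\ b y.

Lemma is_partition1 (A : Type) : is_partition [set [set: A]].
Proof.
split; first by move=> b c -> ->.
by rewrite /cover bigcup_set1.
Qed.

Definition trivial_partition (A : Type) : partition_of A :=
  Partition (is_partition1 A).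

(** ** Splitting a family of sets *)

Section Refinement.
Variables (A X : Type) (g : set A -> set X).

(* The operation [P (x) psi]; [refine] below is used with [g := F' k]
   and [g := G' k]. *)
Definition split1 (P : set (set X)) (psi : set A) : set (set X) :=
  [set g psi `&` b | b in P] `|` [set ~` g psi `&` b | b in P].

(* [split1] applied successively for all the elements of an arbitrary set
   [Delta] of arguments: every argument contributes [g psi] or its complement,
   as selected by [s].  Lemmas [splits_set0] and [splits_setU1] show that on
   finite sets this is iterated [split1], in any order. *)
Definition splits (P : set (set X)) (Delta : set (set A)) : set (set X) :=
  [set (\bigcap_(psi in Delta) (if s psi then g psi else ~` g psi)) `&` b
  | s in [set: set A -> bool] & b in P].

Lemma splits_set0 P : splits P set0 = P.
Proof.
apply/seteqP; split=> [_ [s _ [b Pb <-]]|b Pb].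
  by rewrite bigcap_set0 setTI.
by exists xpredT => //; exists b => //; rewrite bigcap_set0 setTI.
Qed.

Lemma splits_setU1 P Delta psi : ~ Delta psi ->
  splits P (psi |` Delta) = split1 (splits P Delta) psi.
Proof.
move=> Npsi; apply/seteqP; split=> [_ [s _ [b Pb <-]]|c].
  rewrite bigcap_setU1 -setIA.
  set c := (X in _ `&` X).
  have Sc : splits P Delta c by exists s => //; exists b.
  by case: (s psi); [left|right]; exists c.
have key (s : set A -> bool) (t : bool) b : P b ->
    splits P (psi |` Delta) ((if t then g psi else ~` g psi) `&`
      ((\bigcap_(psi in Delta) (if s psi then g psi else ~` g psi)) `&` b)).
  move=> Pb; pose u x := if pselect (x = psi) then t else s x.
  exists u => //; exists b => //; rewrite bigcap_setU1 -setIA; congr (_ `&` (_ `&` _)).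
    by rewrite /u; case: pselect.
  apply: eq_bigcapr => x Dx; rewrite /u; case: pselect => // exp.
  by rewrite exp in Dx.
by case=> -[_ [s _ [b Pb <-]] <-]; [exact: (key s true)|exact: (key s false)].
Qed.

Lemma splits_partition P Delta : is_partition P -> is_partition (splits P Delta).
Proof.
move=> [tP cP]; split.
  move=> _ _ [s _ [b Pb <-]] [t _ [c Pc <-]] [x [/= [xs xb] [xt xc]]].
  have -> : b = c by apply: tP => //; exists x.
  congr (_ `&` _); apply: eq_bigcapr => psi Dpsi.
  move: (xs _ Dpsi) (xt _ Dpsi).
  by case: (s psi); case: (t psi).
rewrite -subTset => x _.
have : cover P id x by rewrite cP.
case=> b Pb bx.
exists ((\bigcap_(psi in Delta)
  (if `[< g psi x >] then g psi else ~` g psi)) `&` b).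
  by exists (fun psi => `[< g psi x >]) => //; exists b.
by split=> // psi _; case: asboolP.
Qed.

End Refinement.

Definition refine (A X : Type) (g : set A -> set X)
    (P : partition_of X) (Delta : set (set A)) : partition_of X :=
  Partition (splits_partition g Delta (blocksP P)).

(** ** Existential PBESs in normal form *)

Inductive fixpoint_sign := Mu | Nu.

(* Data expressions are represented by their semantics.  Indices are 0-based,
   and [pdom i], [qdom k] are the (product) domains of the vectors of parameters and
   of quantified variables. *)
Record pbes := Pbes {
  neqn : nat;
  sign : 'I_neqn -> fixpoint_sign;
  pdom : 'I_neqn -> Type;
  nclause : 'I_neqn -> nat;
  qdom : forall i, 'I_(nclause i) -> Type;
  guard : forall i (k : 'I_(nclause i)), pdom i -> qdom k -> bool;
  ncall : forall i, 'I_(nclause i) -> nat;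
  callee : forall i (k : 'I_(nclause i)), 'I_(ncall k) -> 'I_neqn;
  arg : forall i (k : 'I_(nclause i)) (j : 'I_(ncall k)),
    pdom i -> qdom k -> pdom (callee j) }.

Section Pbes.
Variable S : pbes.

Local Notation I := 'I_(neqn S).
Local Notation K i := 'I_(@nclause S i).

Definition sigE : Type := {i : I & pdom i}.
Definition X (i : I) (v : pdom i) : sigE := existT _ i v.

Definition branch : Type := {i : I & {k : K i & (pdom i * qdom k)%type}}.
Definition B (i : I) (k : K i) (v : pdom i) (w : qdom k) : branch :=
  existT _ i (existT _ k (v, w)).

(* Empty unless the argument is of the form [X_i(v)]. *)
Definition F (i : I) (k : K i) (x : sigE) : set branch :=
  [set b | exists v (w : qdom k), [/\ x = X v, b = B v w & guard v w]].

(* Empty unless the argument is of the form [(i, k, v, w)]. *)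
Definition G (i : I) (k : K i) (b : branch) : set sigE :=
  [set x | exists v (w : qdom k) (j : 'I_(ncall k)),
     b = B v w /\ x = X (arg j v w)].

Definition lift_rel (A : Type) (R : A -> A -> Prop) (a b : set A) : Prop :=
  [set [set y | R x y] | x in a] = [set [set y | R x y] | x in b].

Definition feasible (simD : sigE -> sigE -> Prop)
    (simB : branch -> branch -> Prop) : Prop :=
  (Equivalence simD /\ Equivalence simB) /\
  [/\ forall (i j : I) (v : pdom i) (v' : pdom j), i <> j -> ~ simD (X v) (X v'),
      forall (i : I) (v v' : pdom i), simD (X v) (X v') ->
        forall k : K i, lift_rel simB (F k (X v)) (F k (X v')),
      forall (i j : I) (k : K i) (k' : K j)
          (v : pdom i) (w : qdom k) (v' : pdom j) (w' : qdom k'),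
        i <> j \/ nat_of_ord k <> nat_of_ord k' ->
        ~ simB (B v w) (B v' w')
    & forall (i : I) (k : K i) (v v' : pdom i) (w w' : qdom k),
        simB (B v w) (B v' w') ->
        lift_rel simD (G k (B v w)) (G k (B v' w'))].

Record partition_family := PartitionFamily {
  Phi : forall i : I, partition_of (pdom i);
  Psi : forall (i : I) (k : K i), partition_of (pdom i * qdom k) }.

Definition eqD (P : partition_family) (x y : sigE) : Prop :=
  exists (i : I) (v v' : pdom i),
    [/\ x = X v, y = X v' & same_block (Phi P i) v v'].

Definition eqB (P : partition_family) (x y : branch) : Prop :=
  exists (i : I) (k : K i) (v v' : pdom i) (w w' : qdom k),
    [/\ x = B v w, y = B v' w' & same_block (Psi P k) (v, w) (v', w')].

Definition F' (i : I) (k : K i) (psi : set (pdom i * qdom k)) : set (pdom i) :=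
  [set v | exists w, F k (X v) (B v w) /\ psi (v, w)].

Arguments F' {i} k psi.

Definition G' (i : I) (k : K i) (phi : set sigE) : set (pdom i * qdom k) :=
  [set vw | G k (B vw.1 vw.2) `&` phi !=set0].
Arguments G' {i} k phi.

Definition DeltaD (P : partition_family) (i : I) (k : K i) : set (set sigE) :=
  \bigcup_(j in [set: 'I_(ncall k)])
    [set [set X v | v in phi] | phi in Phi P (callee j)].

Definition HDik (i : I) (k : K i) (P : partition_family) : partition_family :=
  {| Phi := dfwith (Phi P) (refine (F' k) (Phi P i) (Psi P k));
     Psi := Psi P |}.

Definition HBik (i : I) (k : K i) (P : partition_family) : partition_family :=
  {| Phi := Phi P;
     Psi := dfwith (Psi P)
       (dfwith (Psi P (i := i))
          (refine (G' k) (Psi P k) (DeltaD P k))) |}.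

(* [f_{n m_n} \o ... \o f_{11}] *)
Definition compose_all
    (f : forall i : I, K i -> partition_family -> partition_family)
    (P : partition_family) : partition_family :=
  foldl (fun Q i => foldl (fun Q' k => f i k Q') Q (enum (K i))) P (enum I).

Definition HD := compose_all HDik.
Definition HB := compose_all HBik.
Definition H (P : partition_family) : partition_family := HB (HD P).

Definition P0 : partition_family :=
  {| Phi := fun i => trivial_partition (pdom i);
     Psi := fun i k => trivial_partition (pdom i * qdom k) |}.

End Pbes.

Arguments P0 S : clear implicits.

(* Main.v *)
Require Import Defs.
From mathcomp Require Import all_boot.
From mathcomp Require Import boolp classical_sets.
From Stdlib Require Import RelationClasses.

(** [HB] leaves every [Phi] unchanged and [HD] leaves every [Psi] unchanged, so
    [H P = P] forces [HD P = P] and [HB P = P].  A composition of refinements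
    separates whatever one of its factors separates; hence no block of a fixed
    point is cut by any of its splitters [F' k psi] or [G' k phi].  Applied to
    the block of a given branch (resp. of a given call), this yields the
    matching elements that conditions (2) and (4) of feasibility require. *)

Set Implicit Arguments.
Unset Strict Implicit.
Unset Printing Implicit Defensive.

Local Open Scope classical_set_scope.

Lemma foldl_invariant (A St : Type) (f : St -> A -> St) (inv : St -> Prop)
    (s : seq A) (q : St) :
  (forall q a, inv q -> inv (f q a)) -> inv q -> inv (foldl f q s).
Proof. by move=> finv; elim: s q => //= a s IHs q /(finv _ a)/IHs. Qed.

(** [inv] carries what is known of the state up to the first occurrence of [x]. That step turns it
    into [T], which every later step keeps. *)
Lemma foldl_establish (A : eqType) (St : Type) (f : St -> A -> St)
    (inv T : St -> Prop) (x : A) (s : seq A) (q : St) :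
  (forall q a, inv q -> inv (f q a)) -> (forall q a, T q -> T (f q a)) ->
  (forall q, inv q -> T (f q x)) -> x \in s -> inv q -> T (foldl f q s).
Proof.
move=> finv fT fx; elim: s q => //= a s IHs q; rewrite inE.
case/predU1P=> [<-|xs] qinv; first by apply: foldl_invariant => //; exact: fx.
by apply: IHs => //; exact: finv.
Qed.

Section SameBlock.
Variable A : Type.
Implicit Types (P : partition_of A) (x y : A).

Lemma same_block_refl P x : same_block P x x.
Proof.
have [_ cP] := blocksP P.
have [b Pb bx] : cover P id x by rewrite cP.
by exists b.
Qed.

Lemma same_block_sym (P : set (set A)) x y : same_block P x y -> same_block P y x.
Proof. by case=> b Pb [bx bY]; exists b. Qed.

Lemma same_block_trans P x y z :
  same_block P x y -> same_block P y z -> same_block P x z.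
Proof.
have [tP _] := blocksP P.
move=> [b Pb [bx yb]] [c Pc [yc cz]]; exists b => //; split=> //.
by have -> : b = c by apply: tP => //; exists y.
Qed.

Lemma splits_finer (D : Type) (g : set D -> set A) (P : set (set A)) Delta x y :
  same_block (splits g P Delta) x y -> same_block P x y.
Proof. by case=> _ [s _ [b Pb <-]] [[_ bx] [_ bY]]; exists b. Qed.

(** Every block of [splits] lies inside [g d] or inside its complement, according to its selector
    [s d]. *)
Lemma splits_unsplit (D : Type) (g : set D -> set A) (P : set (set A)) Delta d x y :
  same_block (splits g P Delta) x y -> Delta d -> g d x -> g d y.
Proof.
case=> _ [s _ [b Pb <-]] [[sx _] [sy _]] Dd.
by move: (sx _ Dd) (sy _ Dd); case: (s d).
Qed.

(** Related elements have the same class, so a match for each element puts every class met by one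
    set among those met by the other. *)
Lemma lift_rel_total (R : A -> A -> Prop) (a b : set A) : Equivalence R ->
  (forall x, a x -> exists2 y, b y & R x y) ->
  (forall y, b y -> exists2 x, a x & R y x) -> lift_rel R a b.
Proof.
move=> [Rrefl Rsym Rtrans].
have sub (c d : set A) : (forall x, c x -> exists2 y, d y & R x y) ->
    [set [set z | R x z] | x in c] `<=` [set [set z | R x z] | x in d].
  move=> cd _ [x cx <-]; have [y dy Rxy] := cd _ cx; exists y => //.
  apply/seteqP; split=> z; first exact: Rtrans Rxy.
  exact: Rtrans (Rsym _ _ Rxy).
by move=> ab ba; apply/seteqP; split; exact: sub.
Qed.

End SameBlock.

Section FixedPoint.
Variable S : pbes.
Local Notation I := 'I_(neqn S).
Local Notation K i := 'I_(@nclause S i).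
Implicit Types (P Q : partition_family S) (i : I).

Local Arguments F' {S i} k psi.
Local Arguments G' {S i} k phi.

Lemma partition_family_ext P Q :
  (forall i, Phi P i = Phi Q i) -> (forall i (k : K i), Psi P k = Psi Q k) ->
  P = Q.
Proof.
case: P Q => [Phi1 Psi1] [Phi2 Psi2] /= ePhi ePsi; congr PartitionFamily.
  exact: functional_extensionality_dep.
apply: functional_extensionality_dep => i.
exact: functional_extensionality_dep.
Qed.

(** * The induced equivalences *)

Lemma X_inj i : injective (@X S i).
Proof. exact: eq_from_Tagged. Qed.

Lemma B_inj i (k : K i) (v v' : pdom i) (w w' : qdom k) :
  B v w = B v' w' -> (v, w) = (v', w').
Proof. by move=> e; exact: (eq_from_Tagged (eq_from_Tagged e)). Qed.

Lemma eqD_X P i (v v' : pdom i) :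
  eqD P (X v) (X v') <-> same_block (Phi P i) v v'.
Proof.
split=> [[j [u [u' [e e' uu']]]]|vv']; last by exists i, v, v'.
have ij : i = j := congr1 tag e; subst j.
by rewrite (X_inj e) (X_inj e').
Qed.

Lemma eqB_B P i (k : K i) (v v' : pdom i) (w w' : qdom k) :
  eqB P (B v w) (B v' w') <-> same_block (Psi P k) (v, w) (v', w').
Proof.
split=> [[j [l [u [u' [z [z' [e e' uu']]]]]]]|vv'].
  have ij : i = j := congr1 tag e; subst j.
  have kl : k = l := congr1 tag (eq_from_Tagged e); subst l.
  by rewrite (B_inj e) (B_inj e').
by exists i, k, v, v', w, w'.
Qed.

Lemma eqD_equiv P : Equivalence (eqD P).
Proof.
split.
- by move=> [i v]; apply/eqD_X; exact: same_block_refl.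
- move=> _ _ [i [v [v' [-> -> vv']]]]; apply/eqD_X; exact: same_block_sym.
- move=> _ _ [j z] [i [v [v' [-> -> vv']]]] [i' [u [u' [e -> uu']]]].
  have ii' : i = i' := congr1 tag e; subst i'.
  by apply/eqD_X; apply: same_block_trans vv' _; rewrite (X_inj e).
Qed.

Lemma eqB_equiv P : Equivalence (eqB P).
Proof.
split.
- by move=> [i [k [v w]]]; apply/eqB_B; exact: same_block_refl.
- move=> _ _ [i [k [v [v' [w [w' [-> -> vv']]]]]]].
  by apply/eqB_B; exact: same_block_sym.
- move=> _ _ b [i [k [v [v' [w [w' [-> -> vv']]]]]]].
  move=> [i' [k' [u [u' [z [z' [e -> uu']]]]]]].
  have ii' : i = i' := congr1 tag e; subst i'.
  have kk' : k = k' := congr1 tag (eq_from_Tagged e); subst k'.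
  by apply/eqB_B; apply: same_block_trans vv' _; rewrite (B_inj e).
Qed.

(** * Composed refinements *)

Lemma compose_all_invariant
    (f : forall i, K i -> partition_family S -> partition_family S)
    (inv : partition_family S -> Prop) P :
  (forall i (k : K i) Q, inv Q -> inv (f i k Q)) ->
  inv P -> inv (compose_all f P).
Proof.
by move=> finv; apply: foldl_invariant => Q i; apply: foldl_invariant => *; exact: finv.
Qed.

Lemma compose_all_establish
    (f : forall i, K i -> partition_family S -> partition_family S)
    (inv T : partition_family S -> Prop) i (k : K i) P :
  (forall j (l : K j) Q, inv Q -> inv (f j l Q)) ->
  (forall j (l : K j) Q, T Q -> T (f j l Q)) ->
  (forall Q, inv Q -> T (f i k Q)) ->
  inv P -> T (compose_all f P).
Proof.
move=> finv fT fk; apply: (@foldl_establish _ _ _ inv T i).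
- by move=> Q j; apply: foldl_invariant => *; exact: finv.
- by move=> Q j; apply: foldl_invariant => *; exact: fT.
- move=> Q; apply: (@foldl_establish _ _ _ inv T k).
  + by move=> *; exact: finv.
  + by move=> *; exact: fT.
  + exact: fk.
  + by rewrite mem_enum.
- by rewrite mem_enum.
Qed.

Lemma Psi_HD P : Psi (HD P) = Psi P.
Proof. exact: (@compose_all_invariant _ (fun Q => Psi Q = Psi P)). Qed.

Lemma Phi_HB P : Phi (HB P) = Phi P.
Proof. exact: (@compose_all_invariant _ (fun Q => Phi Q = Phi P)). Qed.

Lemma HDik_finer j (l : K j) Q i (v v' : pdom i) :
  same_block (Phi (HDik l Q) i) v v' -> same_block (Phi Q i) v v'.
Proof.
rewrite /=; case: (eqVneq j i) => [ji|ji]; last by rewrite dfwith_out.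
by subst j; rewrite dfwith_in; exact: splits_finer.
Qed.

Lemma HBik_finer j (l : K j) Q i (k : K i) (b b' : pdom i * qdom k) :
  same_block (Psi (HBik l Q) k) b b' -> same_block (Psi Q k) b b'.
Proof.
rewrite /=; case: (eqVneq j i) => [ji|ji]; last by rewrite dfwith_out.
subst j; rewrite dfwith_in.
case: (eqVneq l k) => [lk|lk]; last by rewrite dfwith_out.
by subst l; rewrite dfwith_in; exact: splits_finer.
Qed.

(** When the factor [HDik k] is reached, [Psi] is still that of [P], so [psi] is among its
    splitters. The later factors only refine [Phi], so they cannot merge what it separated. *)
Lemma HD_unsplit P i (k : K i) psi (v v' : pdom i) :
  same_block (Phi (HD P) i) v v' -> blocks (Psi P k) psi -> F' k psi v -> F' k psi v'.
Proof.
move=> vv' Ppsi; move: v v' vv'.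
apply: (@compose_all_establish _ (fun Q => Psi Q = Psi P)
  (fun Q => forall v v', same_block (Phi Q i) v v' -> F' k psi v -> F' k psi v')
  i k) => //.
- by move=> j l Q QT v v' /HDik_finer; exact: QT.
- move=> Q PsiQ v v' /=; rewrite dfwith_in PsiQ => vv'; exact: splits_unsplit vv' Ppsi.
Qed.

(** Dual to [HD_unsplit]: [DeltaD] depends only on [Phi], which no factor of [HB] changes. *)
Lemma HB_unsplit P i (k : K i) phi (b b' : pdom i * qdom k) :
  same_block (Psi (HB P) k) b b' -> DeltaD P k phi -> G' k phi b -> G' k phi b'.
Proof.
move=> bb' Dphi; move: b b' bb'.
apply: (@compose_all_establish _ (fun Q => Phi Q = Phi P)
  (fun Q => forall b b', same_block (Psi Q k) b b' -> G' k phi b -> G' k phi b')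
  i k) => //.
- by move=> j l Q QT b b' /HBik_finer; exact: QT.
- move=> Q PhiQ b b' /=; rewrite !dfwith_in /DeltaD PhiQ => bb'.
  exact: splits_unsplit bb' Dphi.
Qed.

(** * Fixed points are feasible *)

Lemma H_fixed_HD P : H P = P -> HD P = P.
Proof.
move=> HP; apply: partition_family_ext => [i|i k]; last by rewrite Psi_HD.
by rewrite -Phi_HB -/(H P) HP.
Qed.

Lemma H_fixed_feasible P : H P = P -> feasible (eqD P) (eqB P).
Proof.
move=> HP; have HDP := H_fixed_HD HP.
have HBP : HB P = P by rewrite -[in LHS]HDP.
have Feq i (k : K i) v v' : same_block (Phi P i) v v' ->
    forall b, F k (X v) b -> exists2 b', F k (X v') b' & eqB P b b'.
  move=> vv' b [u [w [/X_inj <- -> gvw]]].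
  (* The splitter is the block [psi] of [(v, w)] itself: membership of [v'] in [F' k psi] then
     provides [w'] with [(v', w')] in that block and the guard true. *)
  have [psi Ppsi [psivw _]] := same_block_refl (Psi P k) (v, w).
  have Fv : F' k psi v by exists w; split=> //; exists v, w.
  rewrite -HDP in vv'; have [w' [Fv' psivw']] := HD_unsplit vv' Ppsi Fv.
  by exists (B v' w') => //; apply/eqB_B; exists psi.
have Geq i (k : K i) v v' w w' : same_block (Psi P k) (v, w) (v', w') ->
    forall x, G k (B v w) x -> exists2 x', G k (B v' w') x' & eqD P x x'.
  move=> vv' _ [u [z [j [/B_inj[<- <-] ->]]]].
  (* The splitter is the block of the argument of the [j]-th call, lifted to [sigE]. The matching
     call of [(v', w')] may have another index than [j]. *)
  have [phi Pphi [phix _]] := same_block_refl (Phi P (callee j)) (arg j v w).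
  have DX : DeltaD P k [set X y | y in phi] by exists j => //; exists phi.
  have Gvw : G' k [set X y | y in phi] (v, w).
    by exists (X (arg j v w)); split; [exists v, w, j|exists (arg j v w)].
  rewrite -HBP in vv'; have [x' [Gvw' [y phiy yx']]] := HB_unsplit vv' DX Gvw.
  by exists x' => //; rewrite -yx'; apply/eqD_X; exists phi.
split; first by split; [exact: eqD_equiv|exact: eqB_equiv].
split.
- by move=> i j v v' ij [l [u [u' [/(congr1 tag) /= il /(congr1 tag) /= jl _]]]];
    apply: ij; rewrite il jl.
- move=> i v v' /eqD_X vv' k; apply: lift_rel_total (eqB_equiv P) _ _; apply: Feq => //.
  exact: same_block_sym.
- move=> i j k k' v w v' w' neq [a [c [u [u' [z [z' [e e' _]]]]]]].
  case: neq; apply; first exact: etrans (congr1 tag e) (esym (congr1 tag e')).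
  (* [k] and [k'] live in types depending on [i] and [j]; projecting the clause index to [nat] lets
     them be compared without transport. *)
  pose clause (b : branch S) : nat := tag (tagged b).
  exact: (etrans (congr1 clause e) (esym (congr1 clause e'))).
- move=> i k v v' w w' /eqB_B vv'.
  apply: lift_rel_total (eqD_equiv P) _ _; apply: Geq => //.
  exact: same_block_sym.
Qed.

End FixedPoint.

Theorem theorem3 (S : pbes) (m : nat) :
  iter m.+1 (@H S) (P0 S) = iter m (@H S) (P0 S) ->
  let P := iter m (@H S) (P0 S) in feasible (eqD P) (eqB P).
Proof. by move=> HP P; exact: H_fixed_feasible. Qed.
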